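(* For $n\ge 1$ (with the convention $\mathrm{TH}_2=\mathrm{PF}_1(1)=\emptyset$), $|\mathrm{TH}_{n+1}|=|\mathrm{PF}_n(1)|=\frac{n!\,(n-1)}{2}$.
   Context: Parking functions: $n$ cars numbered $1,\dots,n$ enter in order a one-way street with spots $1,\dots,n$. Given $\alpha=(a_1,\dots,a_n)\in\{1,\dots,n\}^n$, car $i$ drives to spot $a_i$ and parks there if free, otherwise in the first free spot after $a_i$ (failing if none). $\alpha$ is a parking function if all cars park; its displacement is $\sum_i (p_i-a_i)$ where $p_i$ is the spot where car $i$ parks. $\mathrm{PF}_n(1)$ is the set of parking functions of length $n$ with displacement $1$. Tower of Hanoi: for $n\ge2$, the $(n+1)\times(n+1)$ game has disks $0,\dots,n$ labeled by increasing size and pegs $0,\dots,n$, disks on a peg stacked smaller above larger. An ideal state is an arrangement of all disks with disk $n$ alone on peg $0$, peg $n$ the only empty peg, and each of pegs $1,\dots,n-1$ holding at least one of the remaining $n$ disks. $\mathrm{TH}_{n+1}$ is the set of distinct ideal states. *)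

(* Defs.v *)
From mathcomp Require Import all_boot.

Set Implicit Arguments.
Unset Strict Implicit.
Unset Printing Implicit Defensive.

(* Spots and preferences are numbered from 0: the ordinal k : 'I_n stands for
   spot k.+1.  Displacements are differences of spots, so they do not depend on
   this shift. *)

Definition first_free (n : nat) (taken : seq 'I_n) (a : 'I_n) : option 'I_n :=
  ohead [seq p : 'I_n <- enum 'I_n | (a <= p) && (p \notin taken)].

(* Spots where the cars with preferences prefs park, in order of arrival, when
   the spots in taken are already occupied; None if some car fails to park. *)
Fixpoint park (n : nat) (taken prefs : seq 'I_n) : option (seq 'I_n) :=
  if prefs is a :: prefs' then
    if first_free taken a is Some p then
      omap (cons p) (park (p :: taken) prefs')
    else None
  else Some [::].

Definition outcome (n : nat) (alpha : n.-tuple 'I_n) : option (seq 'I_n) :=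
  park [::] alpha.

Definition parking_function (n : nat) (alpha : n.-tuple 'I_n) : bool :=
  isSome (outcome alpha).

(* The truncated subtraction is exact, since a car never parks before its
   preferred spot; the value is only meaningful on parking functions. *)
Definition displacement (n : nat) (alpha : n.-tuple 'I_n) : nat :=
  \sum_(pa <- zip (odflt [::] (outcome alpha)) alpha) (pa.1 - pa.2).

Definition PF (n d : nat) : {set n.-tuple 'I_n} :=
  [set alpha | parking_function alpha & displacement alpha == d].

(* A position of m disks on m pegs gives, for each peg, its disks listed from
   top to bottom.  The length bound of m.-bseq excludes no legal position. *)
Notation hanoi_position m := {ffun 'I_m -> m.-bseq 'I_m}.

Definition hanoi_state (m : nat) (s : hanoi_position m) : bool :=
  [forall p, sorted ltn (map val (s p))] &&
  perm_eq (flatten [seq bseqval (s p) | p <- enum 'I_m]) (enum 'I_m).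

(* In the m x m game the largest disk and the last peg are both numbered m.-1. *)
Definition ideal_state (m : nat) (s : hanoi_position m) : bool :=
  [&& hanoi_state s,
      [forall p : 'I_m, (p == 0 :> nat) ==> (map val (s p) == [:: m.-1])],
      [forall p : 'I_m, nilp (s p) == (p == m.-1 :> nat)]
    & [forall p : 'I_m, (0 < p < m.-1) ==> (0 < size (s p))]].

(* TH 2 is empty, as disk 0 has no peg left; PF 1 1 is empty as well. *)
Definition TH (m : nat) : {set hanoi_position m} := [set s | ideal_state s].

(* Main.v *)
Require Import Defs.
From mathcomp Require Import all_boot all_order all_fingroup all_algebra.

(* Number the N+1 spots and the N middle pegs from 0.  A parking function of displacement 1
   has an outcome s, a permutation, in which exactly one car is bumped, from the
   spot k it prefers to k+1, and k is taken before k+1.  Conversely every such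
   pair (s, k) arises, and it is determined by the parking function.
   An ideal state is a surjection of the N+1 disks other than the largest onto
   the N middle pegs; exactly one peg k receives two disks i < j, and pulling
   these apart by sending i to k, j to k+1 and shifting the later pegs gives
   again a pair (s, k) in which k is reached before k+1.  Exchanging the values
   k and k+1 shows that these pairs are half of all pairs. *)

Set Implicit Arguments.
Unset Strict Implicit.
Unset Printing Implicit Defensive.

Import GRing.Theory.
Local Open Scope nat_scope.

(** * The parking process and its outcomes *)

Lemma first_freeP (n : nat) (t : seq 'I_n) (a p : 'I_n) :
  reflect [/\ a <= p, p \notin t & forall q : 'I_n, a <= q < p -> q \in t]
          (first_free t a == Some p).
Proof.
rewrite /first_free.
have mem_free (q : 'I_n) :
    (q \in [seq q : 'I_n <- enum 'I_n | (a <= q) && (q \notin t)]) =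
      (a <= q) && (q \notin t).
  by rewrite mem_filter mem_enum andbT.
(* Filtering keeps the enumeration strictly increasing, so the head of the list is the least free
   spot from [a] on. *)
have: sorted ltn [seq val q |
              q <- [seq q : 'I_n <- enum 'I_n | (a <= q) && (q \notin t)]].
  rewrite sorted_map sorted_filter //; first by move=> x y z; apply: ltn_trans.
  by rewrite -sorted_map val_enum_ord iota_ltn_sorted.
case: [seq q <- _ | _] mem_free => [|p0 s] mem_free /=.
  move=> _; constructor; case=> ap pt _.
  by have := mem_free p; rewrite ap pt.
rewrite path_map (path_sortedE (fun x y z => @ltn_trans _ _ _)) => /andP[/allP p0_lt _].
have /andP[ap0 p0t] : (a <= p0) && (p0 \notin t) by rewrite -mem_free mem_head.
apply: (iffP eqP) => [[<-]|[ap pt before]].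
  split=> // q /andP[aq qp0]; apply/negPn/negP => qt.
  have : q \in p0 :: s by rewrite mem_free aq.
  rewrite inE => /orP[/eqP qp|/p0_lt /= p0q]; first by rewrite qp ltnn in qp0.
  by rewrite ltnNge ltnW in qp0.
have : p \in p0 :: s by rewrite mem_free ap.
rewrite inE => /orP[/eqP -> //|/p0_lt /= p0p].
by have := before p0; rewrite ap0 p0p (negPf p0t) => /(_ isT).
Qed.

Lemma park_size (n : nat) (s t r : seq 'I_n) :
  park t s = Some r -> size r = size s.
Proof.
elim: s t r => [|a s IHs] t r /=; first by case=> <-.
case: (first_free t a) => // p.
by case E: (park _ s) => [r'|] //= [<-] /=; rewrite (IHs _ _ E).
Qed.

Lemma park_uniq (n : nat) (s t r : seq 'I_n) :
  park t s = Some r -> uniq t -> uniq (catrev r t).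
Proof.
elim: s t r => [|a s IHs] t r /=; first by case=> <-.
case E: (first_free t a) => [p|] //.
have /eqP /first_freeP[_ pt _] := E.
case Ep: (park _ s) => [r'|] //= [<-] ut /=.
by apply: (IHs _ _ Ep); rewrite /= pt.
Qed.

(** Unfolds the recursion into one condition per car: car [i] finds occupied the spots in [t] and
    those of the earlier cars, latest first. *)
Lemma parkP (n : nat) (x : 'I_n) (s t r : seq 'I_n) : size r = size s ->
  park t s = Some r <->
  forall i, i < size s ->
    first_free (rev (take i r) ++ t) (nth x s i) = Some (nth x r i).
Proof.
elim: s t r => [|a s IHs] t [|p r] //= [size_r].
split.
  case E: (first_free t a) => [p'|] //.
  case Ep: (park _ s) => [r'|] //= [<- er] [|i] //= i_lt.
  rewrite rev_cons cat_rcons.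
  by move: Ep; rewrite er; move/(IHs (p' :: t) _ size_r); apply.
move=> free; have /= -> := free 0 isT.
suff -> : park (p :: t) s = Some r by [].
apply/(IHs _ _ size_r) => i i_lt.
by have := free i.+1 i_lt; rewrite /= rev_cons cat_rcons.
Qed.

Lemma mem_take_perm (n i : nat) (s : {perm 'I_n}) (q : 'I_n) :
  (q \in take i [seq s j | j <- enum 'I_n]) = (s^-1%g q < i).
Proof.
have [j ->] : exists j, q = s j by exists (s^-1%g q); rewrite permKV.
rewrite in_take; last by apply: map_f; rewrite mem_enum.
by rewrite (index_map (@perm_inj _ s)) index_enum_ord permK.
Qed.

(** Injectivity of [s] makes [s i] free when car [i] arrives, and [s^-1 q < i] says that [q] is
    taken by then. *)
Lemma outcomeP (n : nat) (alpha : n.-tuple 'I_n) (s : {perm 'I_n}) :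
  outcome alpha = Some [seq s i | i <- enum 'I_n] <->
  forall i, tnth alpha i <= s i /\
    forall q : 'I_n, tnth alpha i <= q < s i -> s^-1%g q < i.
Proof.
have size_s : size [seq s i | i <- enum 'I_n] = size alpha.
  by rewrite size_map size_enum_ord size_tuple.
have nth_s x (i : 'I_n) : nth x [seq s i | i <- enum 'I_n] i = s i.
  by rewrite (nth_map i) ?size_enum_ord // nth_ord_enum.
split=> [out i|parked].
  have/(parkP i _ size_s)/(_ i) := out.
  rewrite size_tuple ltn_ord nth_s -tnth_nth => /(_ isT) /eqP /first_freeP[le _ occ].
  split=> // q /occ.
  by rewrite cats0 mem_rev mem_take_perm.
rewrite /outcome.
(* [parkP] takes a default spot, which exists only for positive length. *)
case: n => [|n] in alpha s size_s nth_s parked *.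
  by move: size_s; rewrite (tuple0 alpha) => /size0nil ->.
apply/(parkP ord0 _ size_s) => i; rewrite size_tuple => i_lt.
have [le occ] := parked (Ordinal i_lt).
have -> : i = Ordinal i_lt by [].
rewrite nth_s -tnth_nth; apply/eqP/first_freeP; split=> //.
  by rewrite cats0 mem_rev mem_take_perm permK ltnn.
by move=> q /occ; rewrite cats0 mem_rev mem_take_perm.
Qed.

Lemma outcome_perm (n : nat) (alpha : n.-tuple 'I_n) (r : seq 'I_n) :
  outcome alpha = Some r ->
  exists s : {perm 'I_n}, r = [seq s i | i <- enum 'I_n].
Proof.
move=> out.
have ur : uniq r by have := park_uniq out isT; rewrite catrevE cats0 rev_uniq.
have/eqP size_r : size r = n by rewrite (park_size out) size_tuple.
pose rt := Tuple size_r.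
have inj_r : injective (tnth rt).
  by apply/injectiveP; rewrite /injectiveb /dinjectiveb map_tnth_enum.
exists (perm inj_r); rewrite (eq_map (permE inj_r)).
by rewrite map_tnth_enum.
Qed.

Lemma displacementE (n : nat) (alpha : n.-tuple 'I_n) (s : {perm 'I_n}) :
  outcome alpha = Some [seq s i | i <- enum 'I_n] ->
  displacement alpha = \sum_(i < n) (s i - tnth alpha i).
Proof.
rewrite /displacement => -> /=.
by rewrite -[X in zip _ X]map_tnth_enum zip_map big_map big_enum.
Qed.

(* For k : 'I_N these are the consecutive elements k and k.+1 of 'I_N.+1. *)
Local Notation lower k := (lift ord_max k).
Local Notation upper k := (lift ord0 k).

(** * Ordered pairs and parking functions of displacement one *)

Definition ordered_pairs (N : nat) : {set {perm 'I_N.+1} * 'I_N} :=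
  [set u : {perm 'I_N.+1} * 'I_N |
     (u.1^-1)%g (lower u.2) < (u.1^-1)%g (upper u.2)].

Definition collide (N : nat) (u : {perm 'I_N.+1} * 'I_N) :
    N.+1.-tuple 'I_N.+1 :=
  [tuple if u.1 i == upper u.2 then lower u.2 else u.1 i | i < N.+1].

Lemma val_lower (N : nat) (k : 'I_N) : lower k = k :> nat.
Proof. by rewrite lift_max. Qed.

Lemma val_upper (N : nat) (k : 'I_N) : upper k = k.+1 :> nat.
Proof. by []. Qed.

(** Every car but the one bound for [upper k] prefers its own spot. That car has only [lower k] to
    pass, which an earlier car has filled. *)
Lemma outcome_collide (N : nat) (s : {perm 'I_N.+1}) (k : 'I_N) :
  (s, k) \in ordered_pairs N ->
  outcome (collide (s, k)) = Some [seq s i | i <- enum 'I_N.+1].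
Proof.
rewrite inE /= => before; apply/outcomeP => i; rewrite tnth_mktuple /=.
have [si|_] := eqVneq (s i) (upper k); last first.
  split=> // q /andP[le lt]; have := leq_ltn_trans le lt.
  by rewrite ltnn.
rewrite si val_lower val_upper; split=> // q /andP[kq qk].
suff -> : q = lower k by rewrite -(permK s i) si.
by apply/ord_inj/eqP; rewrite val_lower eqn_leq kq -ltnS qk.
Qed.

Lemma collide_PF (N : nat) (s : {perm 'I_N.+1}) (k : 'I_N) :
  (s, k) \in ordered_pairs N -> collide (s, k) \in PF N.+1 1.
Proof.
move=> /outcome_collide out.
rewrite inE /parking_function out (displacementE out) /=.
apply/sum_nat_eq1; exists ((s^-1)%g (upper k)); split=> //.
  by rewrite tnth_mktuple permKV eqxx val_lower val_upper subSnn.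
move=> j jk _; rewrite tnth_mktuple /= -[_ == upper k](inj_eq (@perm_inj _ s^-1)).
by rewrite permK (negPf jk) subnn.
Qed.

Lemma PF_collide (N : nat) : PF N.+1 1 = @collide N @: ordered_pairs N.
Proof.
apply/setP=> alpha; apply/idP/imsetP=> [|[[s k] A ->]]; last exact: collide_PF.
rewrite inE /parking_function => /andP[].
case out: (outcome alpha) => [r|] // _.
have [s es] := outcome_perm out; rewrite {}es in out.
(* A sum of naturals equal to 1 has one term 1 and the others 0, so a single car [i] is displaced,
   by one spot. *)
rewrite (displacementE out) => /sum_nat_eq1[i [_ di dj]].
have /outcomeP parked := out.
have si : s i = (tnth alpha i).+1 :> nat.
  by have [le _] := parked i; rewrite -(subnK le) di.
have ki : tnth alpha i < N by rewrite -ltnS -si ltn_ord.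
pose k := Ordinal ki.
have lk : lower k = tnth alpha i by apply/ord_inj; rewrite val_lower.
have uk : upper k = s i by apply/val_inj; rewrite /= si.
exists (s, k).
  (* Car [i] passed over its preferred spot, so that spot was taken earlier. *)
  rewrite inE /= lk uk permK; have [_] := parked i; apply.
  by rewrite leqnn si ltnSn.
apply: eq_from_tnth => j; rewrite tnth_mktuple /= lk uk (inj_eq perm_inj).
have [-> //|ji] := eqVneq j i.
have [le _] := parked j; apply/val_inj/eqP; rewrite eqn_leq le /= -subn_eq0.
by rewrite dj.
Qed.

(** The outcome recovers [s]. The car ending at [upper k] then prefers [k], whereas for any other
    [k'] it would prefer [k.+1]. *)
Lemma collide_inj (N : nat) : {in ordered_pairs N &, injective (@collide N)}.
Proof.
move=> [s k] [s' k'] A A' e.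
have es : s = s'.
  have [] : Some [seq s i | i <- enum 'I_N.+1] =
              Some [seq s' i | i <- enum 'I_N.+1].
    by rewrite -(outcome_collide A) e (outcome_collide A').
  by move/eq_in_map=> es; apply/permP=> i; apply: es; rewrite mem_enum.
subst s'; congr (_, _).
have := congr1 (fun t => tnth t ((s^-1)%g (upper k))) e.
rewrite !tnth_mktuple /= permKV eqxx.
have [/lift_inj //|_] := eqVneq (upper k) (upper k').
by move/(congr1 (@nat_of_ord _)); rewrite val_lower val_upper => /eqP; rewrite ltn_eqF /=.
Qed.

Lemma card_ordered_pairs (N : nat) : #|ordered_pairs N|.*2 = N.+1`! * N.
Proof.
have card_all : #|{: {perm 'I_N.+1} * 'I_N}| = N.+1`! * N.
  by rewrite card_prod card_Sn card_ord.
rewrite -card_all -(cardC (mem (ordered_pairs N))) -addnn; congr (_ + _).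
pose swap (u : {perm 'I_N.+1} * 'I_N) :=
  ((u.1 * tperm (lower u.2) (upper u.2))%g, u.2).
have swapK : involutive swap.
  by move=> [s k]; rewrite /swap /= -mulgA tperm2 mulg1.
rewrite -(card_imset _ (inv_inj swapK)); apply: eq_card => u.
rewrite [RHS]inE.
have -> : (u \in swap @: ordered_pairs N) = (swap u \in ordered_pairs N).
  by rewrite -{1}(swapK u) (mem_imset _ _ (inv_inj swapK)).
case: u => s k; rewrite !inE /= invMg tpermV !permM tpermL tpermR.
(* The complement only gives [<=]; equality would identify [lower k] with [upper k]. *)
rewrite -leqNgt [RHS]leq_eqVlt; case: eqP => //= /ord_inj /perm_inj.
by move/(congr1 (@nat_of_ord _)); rewrite val_lower val_upper => /eqP; rewrite gtn_eqF /=.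
Qed.

(** * Surjections with one double fibre *)

Definition squash (N : nat) (k : 'I_N) (v : 'I_N.+1) : 'I_N :=
  odflt k (unlift (upper k) v).

Lemma squash_lift (N : nat) (k v : 'I_N) : squash k (lift (upper k) v) = v.
Proof. by rewrite /squash liftK. Qed.

Lemma squash_upper (N : nat) (k : 'I_N) : squash k (upper k) = k.
Proof. by rewrite /squash unlift_none. Qed.

Lemma lift_upper (N : nat) (k : 'I_N) : lift (upper k) k = lower k.
Proof. by apply/ord_inj; rewrite val_lower /= /bump /= ltnn. Qed.

Lemma squash_lower (N : nat) (k : 'I_N) : squash k (lower k) = k.
Proof. by rewrite -lift_upper squash_lift. Qed.

(** Away from [upper k], [squash k] inverts the injection [lift (upper k)]. A coincidence thus
    involves [upper k], which the default sends to [k], the image of [lower k]. *)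
Lemma squash_eq (N : nat) (k : 'I_N) (v w : 'I_N.+1) :
  squash k v = squash k w -> v != w ->
  (v = lower k /\ w = upper k) \/ (v = upper k /\ w = lower k).
Proof.
case: (unliftP (upper k) v) => [v' ->|->];
  case: (unliftP (upper k) w) => [w' ->|->];
  rewrite ?squash_lift ?squash_upper ?eqxx //.
- by move=> ->; rewrite eqxx.
- by move=> -> _; left; rewrite lift_upper.
- by move=> <- _; right; rewrite lift_upper.
Qed.

Definition surjections (N : nat) : {set {ffun 'I_N.+1 -> 'I_N}} :=
  [set h : {ffun 'I_N.+1 -> 'I_N} | [forall q, [exists d, h d == q]]].

Definition squash_perm (N : nat) (u : {perm 'I_N.+1} * 'I_N) :
    {ffun 'I_N.+1 -> 'I_N} :=
  [ffun d => squash u.2 (u.1 d)].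

Lemma squash_perm_inj (N : nat) :
  {in ordered_pairs N &, injective (@squash_perm N)}.
Proof.
move=> [s k] [s' k']; rewrite !inE /= => A A' /ffunP e.
have {}e d : squash k (s d) = squash k' (s' d).
  by have := e d; rewrite !ffunE.
set i := (s^-1)%g (lower k) in A; set j := (s^-1)%g (upper k) in A.
have si : s i = lower k by rewrite permKV.
have sj : s j = upper k by rewrite permKV.
have ij : s' i != s' j.
  by rewrite (inj_eq perm_inj); apply: contraTneq A => ->; rewrite ltnn.
have ei : squash k' (s' i) = k by rewrite -e si squash_lower.
have ej : squash k' (s' j) = k by rewrite -e sj squash_upper.
(* [s' i] and [s' j] are the two values merged by [squash k']; the reversed assignment contradicts
   the order condition on [(s', k')]. *)
have [[s'i s'j]|[s'i s'j]] := squash_eq (etrans ei (esym ej)) ij; last first.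
  by move: A'; rewrite -s'i -s'j !permK ltnNge ltnW.
have kk' : k' = k by rewrite -ei s'i squash_lower.
subst k'; congr (_, _); apply/permP => d.
have [//|sd] := eqVneq (s d) (s' d).
have [[sd1 _]|[sd1 _]] := squash_eq (e d) sd.
  by rewrite sd1; move: sd1; rewrite -si => /perm_inj ->; rewrite s'i -si.
by rewrite sd1; move: sd1; rewrite -sj => /perm_inj ->; rewrite s'j -sj.
Qed.

Lemma surjections_squash (N : nat) :
  surjections N = @squash_perm N @: ordered_pairs N.
Proof.
apply/setP => h; apply/idP/imsetP => [|[[s k] _ ->]]; last first.
  rewrite inE; apply/forallP => q; apply/existsP.
  by exists ((s^-1)%g (lift (upper k) q)); rewrite ffunE permKV squash_lift.
rewrite inE => /forallP surj.
have [i [j [ij hij]]] : exists i j : 'I_N.+1, i < j /\ h i = h j.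
  have /injectivePn[i [j ij hij]] : ~~ injectiveb h.
    by apply/injectiveP => /leq_card; rewrite !card_ord ltnn.
  have [lt|lt|/ord_inj e] := ltngtP i j; last by rewrite e eqxx in ij.
    by exists i, j.
  by exists j, i.
pose k := h j.
(* [lift (upper k)] leaves a gap at [k.+1], which [j] alone fills, while [i] stays at [lower k]. *)
pose f d := if d == j then upper k else lift (upper k) (h d).
have f_surj q : exists d, f d = q.
  have [v ->|->] := unliftP (upper k) q; last by exists j; rewrite /f eqxx.
  have /existsP[d /eqP hd] := surj v.
  have [dj|dj] := eqVneq d j; last by exists d; rewrite /f (negPf dj) hd.
  (* If the preimage found is [j], then [i] has the same image under [h] and replaces it. *)
  exists i; rewrite /f (_ : i == j = false) ?hij -?dj ?hd //.
  by rewrite dj; apply/negP => /eqP e; rewrite e ltnn in ij.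
have f_inj : injective f.
  (* A surjective self-map of a finite set is injective; hence [i] and [j] are the only coincidence
     of [h]. *)
  suff /image_injP f_in : #|image f 'I_N.+1| == #|'I_N.+1|
    by move=> x y; apply: f_in.
  by apply/eqP/eq_card => q; rewrite [RHS]inE;
    have [d <-] := f_surj q; rewrite codom_f.
have fj : f j = upper k by rewrite /f eqxx.
have fi : f i = lower k.
  by rewrite /f -(inj_eq (@ord_inj _)) ltn_eqF // hij lift_upper.
exists (perm f_inj, k).
  by rewrite inE /= -fi -fj -(permE f_inj i) -(permE f_inj j) !permK.
apply/ffunP => d; rewrite ffunE permE /f.
by have [->|_] := eqVneq d j; rewrite ?squash_upper ?squash_lift.
Qed.

(** * Hanoi positions as maps from disks to pegs *)

Definition position_of (m : nat) (h : {ffun 'I_m -> 'I_m}) : hanoi_position m :=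
  [ffun p => insub_bseq m [seq d <- enum 'I_m | h d == p]].

Lemma position_ofE (m : nat) (h : {ffun 'I_m -> 'I_m}) (p : 'I_m) :
  position_of h p = [seq d <- enum 'I_m | h d == p] :> seq _.
Proof.
rewrite ffunE [LHS]insubdK // unfold_in size_filter.
by rewrite (leq_trans (count_size _ _)) // size_enum_ord.
Qed.

Lemma mem_position_of (m : nat) (h : {ffun 'I_m -> 'I_m}) (p d : 'I_m) :
  (d \in bseqval (position_of h p)) = (h d == p).
Proof. by rewrite position_ofE mem_filter mem_enum andbT. Qed.

Lemma sorted_position_of (m : nat) (h : {ffun 'I_m -> 'I_m}) (p : 'I_m) :
  sorted ltn (map val (position_of h p)).
Proof.
rewrite position_ofE sorted_map sorted_filter //.
  by move=> x y z; apply: ltn_trans.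
by rewrite -sorted_map val_enum_ord iota_ltn_sorted.
Qed.

Lemma position_of_inj (m : nat) : injective (@position_of m).
Proof.
move=> h h' e; apply/ffunP => d; apply/esym/eqP.
by rewrite -mem_position_of -e mem_position_of.
Qed.

(** Each disk occurs once in all, hence on one peg, and the order on a peg is forced: strictly
    increasing lists with the same members are equal. *)
Lemma hanoi_stateP (m : nat) (s : hanoi_position m) :
  reflect (exists h, s = position_of h) (hanoi_state s).
Proof.
have count_disk (d : 'I_m) :
    count_mem d (flatten [seq bseqval (s p) | p <- enum 'I_m]) =
      \sum_p count_mem d (s p).
  by rewrite count_flatten sumnE 2!big_map big_enum.
apply: (iffP andP) => [[/forallP sorted_s perm_s]|[h es]]; last first.
  split.
    by apply/forallP => p; rewrite es sorted_position_of.
  apply/allP => d _ /=; rewrite count_disk.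
  rewrite (count_uniq_mem d (enum_uniq 'I_m)) mem_enum /=.
  apply/sum_nat_eq1; exists (h d); split=> //.
    rewrite es count_uniq_mem ?mem_position_of ?eqxx //.
    by rewrite position_ofE filter_uniq ?enum_uniq.
  move=> p ne _; apply/count_memPn; rewrite es mem_position_of.
  by rewrite eq_sym.
have peg_exists d : exists p, forall p', (d \in bseqval (s p')) = (p == p').
  have /sum_nat_eq1[p [_ p1 p0]] : \sum_p count_mem d (s p) == 1.
    rewrite -count_disk (seq.permP perm_s) (count_uniq_mem d (enum_uniq 'I_m)).
    by rewrite mem_enum.
  exists p => p'; have [<-|ne] := eqVneq p p'.
    by rewrite -has_pred1 has_count p1.
  by apply/count_memPn/p0 => //; rewrite eq_sym.
have [h hP] := fin_all_exists peg_exists.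
exists (finfun h); apply/ffunP => p; apply/val_inj.
apply: (inj_map val_inj).
apply: (irr_sorted_eq ltn_trans ltnn (sorted_s p) (sorted_position_of _ _)).
apply: eq_mem_map => d.
by rewrite /= mem_position_of ffunE hP.
Qed.

(** The contents of the pegs are the fibres of [h], so ideality means that [h] maps the disks other
    than the largest onto the middle pegs. *)
Lemma ideal_positionP (N : nat) (h : {ffun 'I_N.+2 -> 'I_N.+2}) :
  reflect [/\ forall d, (h d == ord0) = (d == ord_max), forall d, h d != ord_max
            & forall p : 'I_N.+2, 0 < p < N.+1 -> exists d, h d = p]
          (ideal_state (position_of h)).
Proof.
have nilE p : nilp (position_of h p) = ~~ [exists d, h d == p].
  rewrite -[LHS]negbK; congr (~~ _).
  apply/idP/existsP => [|[d hd]].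
    rewrite -lt0n -has_predT => /hasP[d]; rewrite mem_position_of.
    by exists d.
  by apply/negP => /nilP e; rewrite -mem_position_of e in hd.
apply: (iffP and4P) => [[_ /forallP peg0 /forallP nil /forallP mid]|[peg0 nil mid]].
  split=> [d|d|p].
  - rewrite -mem_position_of.
    have /eqP := peg0 ord0.
    rewrite -[[:: _]]/(map val [:: ord_max : 'I_N.+2]).
    by move/(inj_map val_inj) => ->; rewrite inE.
  - apply/negP => hd; have := nil ord_max.
    by rewrite nilE eqxx => /eqP /existsP[]; exists d.
  - have := mid p; rewrite (lt0n (size _)) -/(nilp _) nilE negbK => /implyP H /H.
    by case/existsP => d /eqP; exists d.
split.
- by apply/hanoi_stateP; exists h.
- apply/forallP => p; apply/implyP => p0.
  have -> : p = ord0 by apply/ord_inj/eqP.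
  rewrite position_ofE (eq_filter peg0) filter_pred1_uniq ?enum_uniq //.
  by rewrite mem_enum.
- apply/forallP => p; rewrite nilE; apply/eqP.
  have [->|ne] := eqVneq p ord_max.
    by rewrite eqxx; apply/existsP => -[d]; apply/negP.
  rewrite -val_eqE /= in ne; rewrite (negPf ne); apply/negbTE; rewrite negbK.
  apply/existsP; have [p0|p0] := eqVneq p ord0.
    by exists ord_max; rewrite p0 peg0.
  have [|d hd] := mid p; last by exists d; rewrite hd.
  by rewrite lt0n -val_eqE /= in p0 *; rewrite p0 ltn_neqAle ne -ltnS ltn_ord.
apply/forallP => p; apply/implyP => /mid[d hd].
by rewrite (lt0n (size _)) -/(nilp _) nilE negbK; apply/existsP; exists d; rewrite hd.
Qed.

(** [lower] keeps a value and [upper] adds one, so [upper (lower q)] is the middle peg [q.+1]. *)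
Definition arrange (N : nat) (g : {ffun 'I_N.+1 -> 'I_N}) :
    {ffun 'I_N.+2 -> 'I_N.+2} :=
  [ffun d => if unlift ord_max d is Some d' then upper (lower (g d')) else ord0].

Lemma arrange_inj (N : nat) : injective (@arrange N).
Proof.
move=> g g' /ffunP e; apply/ffunP => d.
by have := e (lower d); rewrite !ffunE liftK => /lift_inj/lift_inj.
Qed.

Lemma TH_arrange (N : nat) :
  TH N.+2 = (@position_of N.+2 \o @arrange N) @: surjections N.
Proof.
have middle (q : 'I_N) : upper (lower q) = q.+1 :> nat.
  by rewrite val_upper val_lower.
have lower_max (d : 'I_N.+1) : (lower d == ord_max) = false.
  by apply/negbTE; rewrite eq_sym neq_lift.
apply/setP => s; apply/idP/imsetP => [|[g]]; last first.
  rewrite !inE => /forallP surj -> /=; apply/ideal_positionP; split=> [d|d|p].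
  - by rewrite ffunE; case: unliftP => [d' ->|->]; rewrite ?eqxx //.
  - rewrite ffunE; case: unliftP => [d' _|_] //.
    apply/eqP => /(congr1 (@nat_of_ord _)); rewrite middle => /eqP.
    by rewrite eqSS ltn_eqF.
  - move=> /andP[p0 pN].
    have pN' : p.-1 < N by rewrite -ltnS prednK.
    have /existsP[d /eqP gd] := surj (Ordinal pN').
    exists (lower d); rewrite ffunE liftK gd; apply/ord_inj.
    by rewrite middle /= prednK.
rewrite inE => ideal; have /and4P[/hanoi_stateP[h es] _ _ _] := ideal.
subst s; have /ideal_positionP[peg0 nil mid] := ideal.
(* A smaller disk avoids both peg 0 and the last peg, so its peg is a middle one. *)
have peg_exists (d : 'I_N.+1) : exists q : 'I_N, h (lower d) = upper (lower q).
  have := nil (lower d); have := peg0 (lower d).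
  rewrite lower_max.
  case: (unliftP ord0 (h (lower d))) => [p ->|->]; last by rewrite eqxx.
  case: (unliftP ord_max p) => [q ->|->]; first by exists q.
  by move=> _ /eqP[]; apply/ord_inj.
have [g gP] := fin_all_exists peg_exists.
exists (finfun g); last first.
  congr position_of; apply/ffunP => d; rewrite ffunE.
  case: unliftP => [d' ->|->]; first by rewrite ffunE gP.
  by apply/eqP; rewrite peg0.
rewrite inE; apply/forallP => q; apply/existsP.
have [|d hd] := mid (upper (lower q)); first by rewrite middle; apply: ltn_ord.
move: hd; case: (unliftP ord_max d) => [d' ->|->].
  by rewrite gP => /lift_inj/lift_inj e; exists d'; rewrite ffunE e.
by have := peg0 ord_max; rewrite eqxx => /eqP -> .
Qed.

(** * The two counts *)

Lemma card_TH (N : nat) : #|TH N.+2| = #|ordered_pairs N|.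
Proof.
rewrite TH_arrange card_imset; last first.
  exact: inj_comp (@position_of_inj _) (@arrange_inj _).
by rewrite surjections_squash (card_in_imset (@squash_perm_inj N)).
Qed.

Lemma card_PF (N : nat) : #|PF N.+1 1| = #|ordered_pairs N|.
Proof. by rewrite PF_collide (card_in_imset (@collide_inj N)). Qed.

Local Open Scope ring_scope.

Theorem theorem4 (n : nat) (n_ge1 : (1 <= n)%N) :
  #|TH n.+1| = #|PF n 1| /\
  #|PF n 1|%:R = n`!%:R * (n%:R - 1) / 2%:R :> rat.
Proof.
(* With [n = N.+1] the factor [n - 1] is [N]; for [N = 0] there are no pairs, since ['I_0] is
   empty. *)
case: n n_ge1 => // N _; rewrite card_TH card_PF; split=> //.
by rewrite -natr1 addrK -natrM -card_ordered_pairs -muln2 natrM mulfK.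
Qed.
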